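(* Let $n\ge2$, let $a\in\mathbb{Z}^n$ be a row vector with positive components whose greatest common divisor is $1$, and suppose $\|a\|\ge 2^{(n/2+1)n}$. Let $V$ be an $n\times(n-1)$ matrix whose columns are an LLL-reduced basis of the lattice $\mathbb{N}(a)=\{x\in\mathbb{Z}^n\mid ax=0\}$, let $b$ be an integral column vector with $ab=1$, and let $p$ be the $(n-1)$st row of $(V,b)^{-1}$. Let $\lambda\in\mathbb{Q}$ and $r\in\mathbb{Q}^n$ be defined by $a=\lambda p+r$ with $r\perp p$, and assume without loss of generality (replacing $p$ by $-p$ if necessary) that $\lambda>0$. Then $r\ne0$, and (1) $\|p\|\,\|r\|\le\|a\|\,g(a)$; (2) $\|r\|/\lambda\le 2g(a)$.
   Context: $\|\cdot\|$ is the Euclidean norm; $(V,b)$ is the $n\times n$ matrix obtained by appending the column $b$ to $V$. For an $n$-vector $a$, $g(a)=2^{(n-2)/4}/\|a\|^{1/(n-1)}$. LLL-reducedness: linearly independent vectors $b_1,\dots,b_k$ with Gram–Schmidt orthogonalization $b_1^*,\dots,b_k^*$, i.e. $b_1=b_1^*$ and $b_i=b_i^*+\sum_{j<i}\mu_{ij}b_j^*$ with $\mu_{ij}=b_i^Tb_j^*/\|b_j^*\|^2$, are LLL-reduced if $|\mu_{ij}|\le 1/2$ for all $1\le j<i\le k$ and $\|b_i^*\|^2\le 2\|b_{i+1}^*\|^2$ for all $1\le i\le k-1$. A basis of a lattice is LLL-reduced if its vectors, in the given order, satisfy these conditions. *)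

(* Defs.v *)
From HB Require Import structures.
From mathcomp Require Import all_boot all_order all_algebra.
From mathcomp Require Import reals exp.
Set Implicit Arguments.
Unset Strict Implicit.
Unset Printing Implicit Defensive.
Import Order.TTheory GRing.Theory Num.Theory.
Local Open Scope ring_scope.

Definition enorm (R : realType) (n : nat) (v : 'rV[R]_n) : R :=
  Num.sqrt (\sum_(j < n) v 0 j ^+ 2).

Definition dotc (F : realFieldType) (n : nat) (x y : 'cV[F]_n) : F :=
  (x^T *m y) 0 0.

Section LLL.
Variables (F : realFieldType) (n k : nat).
Implicit Types B Bs : 'M[F]_(n, k).

Definition gs_coef B Bs (i j : 'I_k) : F :=
  dotc (col i B) (col j Bs) / dotc (col j Bs) (col j Bs).

(* Read by increasing i, these equations determine Bs from B. *)
Definition gram_schmidt B Bs : Prop :=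
  forall i : 'I_k,
    col i B = col i Bs + \sum_(j < k | (j < i)%N) gs_coef B Bs i j *: col j Bs.

Definition LLL_reduced B : Prop :=
  row_free B^T /\
  exists Bs : 'M[F]_(n, k),
    [/\ gram_schmidt B Bs,
        forall i j : 'I_k, (j < i)%N -> `|gs_coef B Bs i j| <= 1 / 2
      & forall i j : 'I_k, j = i.+1 :> nat ->
          dotc (col i Bs) (col i Bs) <= 2 * dotc (col j Bs) (col j Bs)].
End LLL.

Definition lattice_basis (n k : nat) (V : 'M[int]_(n, k))
    (L : 'cV[int]_n -> Prop) : Prop :=
  row_free (map_mx intr V : 'M[rat]_(n, k))^T /\
  forall x : 'cV[int]_n, L x <-> exists y : 'cV[int]_k, x = V *m y.

Definition int_null (n : nat) (a : 'rV[int]_n) (x : 'cV[int]_n) : Prop :=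
  a *m x = 0.

(* row_mx V b would have width n.-1 + 1, which is not convertible to n. *)
Definition append_col (T : Type) (n : nat) (V : 'M[T]_(n, n.-1))
    (b : 'cV[T]_n) : 'M[T]_n :=
  \matrix_(i < n, j < n)
    if insub (j : nat) is Some j' then V i j' else b i ord0.

Definition gbound (R : realType) (n : nat) (a : 'rV[R]_n) : R :=
  2 `^ ((n%:R - 2) / 4) / enorm a `^ (1 / (n%:R - 1)).

(* Main.v *)
(** Let [w] be the last Gram-Schmidt vector of [V].  The row [p] annihilates all
    columns of [V] but the last, on which it is [+-1], so it is an orthogonal
    combination of [a] and [w]; computing norms gives
    [|p| |r| = |a| / |w|].  Since [a] is primitive, the Gram determinant of [V]
    is [|a|^2], and the LLL conditions bound it by
    [2 ^ ((n-1)(n-2)/2) |w| ^ (2(n-1))], that is [1 / |w| <= g(a)], whence (1).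
    For (2), [p] is a nonzero integer vector, so [|p| >= 1], and the size of [a]
    forces [|w|^2 >= 2]; hence the component of [p] along [a] dominates,
    which gives [lam != 0] and [|r| / lam <= 2 / |w|]. *)
Require Import Defs.
From HB Require Import structures.
From mathcomp Require Import all_boot all_order all_algebra.
From mathcomp Require Import reals exp.
From mathcomp Require Import ring lra zify.
Set Implicit Arguments.
Unset Strict Implicit.
Unset Printing Implicit Defensive.
Import Order.TTheory GRing.Theory Num.Theory.
Local Open Scope ring_scope.

(** * Inner products and squared norms *)

Lemma dotcE (F : realFieldType) (n : nat) (x y : 'cV[F]_n) :
  dotc x y = \sum_i x i 0 * y i 0.
Proof. by rewrite /dotc mxE; apply: eq_bigr => i _; rewrite mxE. Qed.

Lemma dotcC (F : realFieldType) (n : nat) (x y : 'cV[F]_n) :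
  dotc x y = dotc y x.
Proof. by rewrite !dotcE; apply: eq_bigr => i _; rewrite mulrC. Qed.

Lemma dotcBr (F : realFieldType) (n : nat) (x y z : 'cV[F]_n) :
  dotc x (y - z) = dotc x y - dotc x z.
Proof. by rewrite /dotc mulmxBr mxE [X in _ + X]mxE. Qed.

Lemma dotcZr (F : realFieldType) (n : nat) (c : F) (x y : 'cV[F]_n) :
  dotc x (c *: y) = c * dotc x y.
Proof. by rewrite /dotc -scalemxAr mxE. Qed.

Lemma dotc_sumr (F : realFieldType) (n : nat) (I : finType) (P : pred I)
    (x : 'cV[F]_n) (y : I -> 'cV[F]_n) :
  dotc x (\sum_(i | P i) y i) = \sum_(i | P i) dotc x (y i).
Proof. by rewrite /dotc mulmx_sumr summxE. Qed.

Lemma mulmx_trE (F : comPzRingType) (n : nat) (x : 'rV[F]_n) :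
  (x *m x^T) 0 0 = \sum_j x 0 j ^+ 2.
Proof. by rewrite mxE; apply: eq_bigr => j _; rewrite mxE expr2. Qed.

Lemma mulmx_tr_ge0 (F : realDomainType) (n : nat) (x : 'rV[F]_n) :
  0 <= (x *m x^T) 0 0.
Proof. by rewrite mulmx_trE sumr_ge0 // => j _; rewrite sqr_ge0. Qed.

Lemma mulmx_tr_eq0 (F : realDomainType) (n : nat) (x : 'rV[F]_n) :
  ((x *m x^T) 0 0 == 0) = (x == 0).
Proof.
apply/idP/eqP => [|->]; last by rewrite mul0mx mxE.
rewrite mulmx_trE psumr_eq0 => [/allP h|j _]; last by rewrite sqr_ge0.
apply/rowP => j; rewrite mxE; apply/eqP.
by have := h j (mem_index_enum j); rewrite /= sqrf_eq0.
Qed.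

Lemma mulmx_tr_gt0 (F : realDomainType) (n : nat) (x : 'rV[F]_n) :
  (0 < (x *m x^T) 0 0) = (x != 0).
Proof. by rewrite lt0r mulmx_tr_eq0 mulmx_tr_ge0 andbT. Qed.

Lemma dotc_ge0 (F : realFieldType) (n : nat) (x : 'cV[F]_n) : 0 <= dotc x x.
Proof. by have := mulmx_tr_ge0 x^T; rewrite trmxK. Qed.

Lemma dotc_eq0 (F : realFieldType) (n : nat) (x : 'cV[F]_n) :
  (dotc x x == 0) = (x == 0).
Proof.
by have := mulmx_tr_eq0 x^T; rewrite trmxK -(inj_eq trmx_inj x) trmx0.
Qed.

(** * Gram-Schmidt orthogonalization and the LLL conditions *)

Section GramSchmidt.
Variables (F : realFieldType) (n k : nat) (B Bs : 'M[F]_(n, k)).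
Hypothesis gsB : gram_schmidt B Bs.

(** Strong induction on the larger index: in the product of [col j Bs] with [col i B] minus its
    projections, only the projection on [col j Bs] survives, and it cancels the first term. *)
Lemma gs_orthogonal_lt (i j : 'I_k) :
  (j < i)%N -> dotc (col j Bs) (col i Bs) = 0.
Proof.
have [m] := ubnP (i : nat); elim: m i j => // m IH i j /ltnSE-le_im lt_ji.
(* A zero [col j Bs] makes the coefficient a division by zero, so it is settled first. *)
have [->|nz_j] := eqVneq (col j Bs) 0; first by rewrite /dotc trmx0 mul0mx mxE.
have -> : col i Bs = col i B - \sum_(l < k | (l < i)%N) gs_coef B Bs i l *: col l Bs.
  by rewrite (gsB i) addrK.
rewrite dotcBr dotc_sumr (bigD1 j) //= big1 => [|l /andP[lt_li ne_lj]].
  by rewrite addr0 dotcZr /gs_coef divfK ?dotc_eq0 // dotcC subrr.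
rewrite dotcZr; have [lt_jl|lt_lj|/val_inj eq_lj] := ltngtP j l.
- by rewrite IH ?mulr0 // (leq_trans lt_li).
- by rewrite dotcC IH ?mulr0 // (leq_trans lt_ji).
- by rewrite eq_lj eqxx in ne_lj.
Qed.

Lemma gs_orthogonal (i j : 'I_k) :
  i != j -> dotc (col i Bs) (col j Bs) = 0.
Proof.
move=> ne_ij; have [lt|lt|/val_inj e] := ltngtP i j.
- exact: gs_orthogonal_lt.
- by rewrite dotcC gs_orthogonal_lt.
- by rewrite e eqxx in ne_ij.
Qed.

Lemma gs_gram : Bs^T *m Bs = diag_mx (\row_i dotc (col i Bs) (col i Bs)).
Proof.
apply/matrixP => i j; rewrite [RHS]mxE.
have -> : (Bs^T *m Bs) i j = dotc (col i Bs) (col j Bs).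
  by rewrite dotcE mxE; apply: eq_bigr => l _; rewrite !mxE.
by have [->|ne] := eqVneq i j; [rewrite mxE | rewrite gs_orthogonal].
Qed.

(** The upper unitriangular change of basis; rows index Gram-Schmidt vectors and columns index basis
    vectors, the reverse of [gs_coef]. *)
Definition gs_mx : 'M[F]_k :=
  \matrix_(j, i) if (j < i)%N then gs_coef B Bs i j else (j == i)%:R.

Lemma gs_factor : B = Bs *m gs_mx.
Proof.
apply/matrixP => x i.
have /colP/(_ x) := gsB i; rewrite !mxE summxE => ->.
rewrite [RHS](bigID (fun j : 'I_k => (j < i)%N)) /= addrC; congr (_ + _).
  by apply: eq_bigr => j lt_ji; rewrite !mxE lt_ji mulrC.
rewrite (bigD1 i) ?ltnn //= big1 => [|j /andP[ge_ji ne_ji]].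
  by rewrite !mxE ltnn eqxx mulr1 addr0.
by rewrite !mxE (negbTE ge_ji) (negbTE ne_ji) mulr0.
Qed.

Lemma det_gs_mx : \det gs_mx = 1.
Proof.
rewrite -det_tr det_trig; last first.
  apply/is_trig_mxP => i j lt_ij; rewrite !mxE ltnNge (ltnW lt_ij) /=.
  by case: eqVneq lt_ij => // ->; rewrite ltnn.
by rewrite big1 // => i _; rewrite !mxE ltnn eqxx.
Qed.

Lemma gs_mx_unit : gs_mx \in unitmx.
Proof. by rewrite unitmxE det_gs_mx unitr1. Qed.

Lemma det_gram : \det (B^T *m B) = \prod_i dotc (col i Bs) (col i Bs).
Proof.
rewrite {1 2}gs_factor trmx_mul mulmxA -(mulmxA gs_mx^T) gs_gram.
rewrite !det_mulmx det_tr det_gs_mx det_diag mul1r mulr1.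
by apply: eq_bigr => i _; rewrite mxE.
Qed.

End GramSchmidt.

(** In [B = Bs *m gs_mx], orthogonality leaves only the last row of [gs_mx], which is a unit vector
    by triangularity. *)
Lemma gs_last_mul (F : realFieldType) (n k : nat) (B Bs : 'M[F]_(n, k.+1)) :
  gram_schmidt B Bs ->
  (col ord_max Bs)^T *m B =
    dotc (col ord_max Bs) (col ord_max Bs) *: delta_mx 0 ord_max.
Proof.
move=> gsB; rewrite [X in _ *m X](gs_factor gsB) mulmxA.
have -> : (col ord_max Bs)^T *m Bs =
    dotc (col ord_max Bs) (col ord_max Bs) *: delta_mx 0 ord_max.
  apply/rowP => j; rewrite [RHS]mxE [in RHS]mxE eqxx /=.
  have -> : ((col ord_max Bs)^T *m Bs) 0 j = dotc (col ord_max Bs) (col j Bs).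
    by rewrite dotcE mxE; apply: eq_bigr => l _; rewrite !mxE.
  have [->|ne] := eqVneq j ord_max; first by rewrite mulr1.
  by rewrite (gs_orthogonal gsB) ?mulr0 // eq_sym.
rewrite -scalemxAl -rowE; congr (_ *: _).
by apply/rowP => j; rewrite !mxE ltnNge -ltnS ltn_ord /= eq_sym.
Qed.

(** Each step towards the last index costs a factor 2, so the [i]-th squared norm is at most
    [2 ^+ (k - i) * W]; the exponents add up to ['C(k.+1, 2)]. *)
Lemma LLL_prod_le (F : realFieldType) (n k : nat) (B Bs : 'M[F]_(n, k.+1)) :
  (forall i j : 'I_k.+1, j = i.+1 :> nat ->
     dotc (col i Bs) (col i Bs) <= 2 * dotc (col j Bs) (col j Bs)) ->
  \prod_i dotc (col i Bs) (col i Bs) <=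
    2 ^+ 'C(k.+1, 2) * dotc (col ord_max Bs) (col ord_max Bs) ^+ k.+1.
Proof.
set W := dotc (col ord_max Bs) _ => lovasz.
have dist d (i : 'I_k.+1) : (i + d = k)%N -> dotc (col i Bs) (col i Bs) <= 2 ^+ d * W.
  elim: d i => [|d IH] i e.
    have -> : i = ord_max by apply: val_inj => /=; lia.
    by rewrite mul1r.
  have lt_i : (i.+1 < k.+1)%N by lia.
  apply: le_trans (lovasz i (Ordinal lt_i) erefl) _.
  rewrite exprS -mulrA ler_pM2l ?ltr0n //; apply: IH => /=; lia.
apply: (@le_trans _ _ (\prod_(i < k.+1) (2 ^+ (k - i) * W))).
  apply: ler_prod => i _; rewrite dotc_ge0 dist //; have := ltn_ord i; lia.
rewrite big_split /= prodr_const card_ord prodrXr (reindex_inj rev_ord_inj) /=.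
rewrite -bin2_sum big_mkord [X in 2 ^+ X](eq_bigr (fun i : 'I_k.+1 => i : nat)) //.
by move=> i _; have := ltn_ord i; lia.
Qed.

(** * The lattice orthogonal to [a] *)

Lemma unitmx_surj (R : comUnitRingType) (n : nat) (M : 'M[R]_n) :
  (forall x : 'cV[R]_n, exists z : 'cV[R]_n, x = M *m z) -> M \in unitmx.
Proof.
move=> surj; have /fin_all_exists[f fE] j := surj (delta_mx j 0).
have /mulmx1_unit[] // : M *m (\matrix_(i, j) f j i 0) = 1%:M.
apply/matrixP => i j; have /colP/(_ i) := fE j; rewrite !mxE eqxx andbT => ->.
by apply: eq_bigr => l _; rewrite !mxE.
Qed.

Section NullLattice.
Variables (n k : nat) (a : 'rV[int]_n) (b : 'cV[int]_n) (V : 'M[int]_(n, k)).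
Hypotheses (V_basis : lattice_basis V (int_null a)) (ab1 : a *m b = 1%:M).

(** Since [a *m b = 1], the vector [x - b *m (a *m x)] is killed by [a]. *)
Lemma null_lattice_decomp (x : 'cV[int]_n) :
  exists y : 'cV[int]_k, x = b *m (a *m x) + V *m y.
Proof.
have /V_basis.2[y yE] : int_null a (x - b *m (a *m x)).
  by rewrite /int_null mulmxBr (mulmxA a b) ab1 mul1mx subrr.
by exists y; rewrite -yE addrC subrK.
Qed.

Lemma null_lattice_mul0 : a *m V = 0.
Proof.
apply/matrixP => i j; have : int_null a (V *m delta_mx j 0).
  by apply/V_basis.2; exists (delta_mx j 0).
by rewrite /int_null mulmxA -colE => /colP/(_ i); rewrite !mxE.
Qed.

End NullLattice.

(** The matrix [(b, V)] is unimodular, and [(a^T, V)] is its product with a block triangular matrix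
    of determinant [A]. The Gram matrix of [(a^T, V)] is block diagonal, so comparing determinants
    gives [A * A = A * \det (V^T *m V)]. The dimension [1 + k] makes these block matrices square. *)
Lemma det_gram_null_lattice (k : nat) (a : 'rV[int]_(1 + k)) (b : 'cV[int]_(1 + k))
    (V : 'M[int]_(1 + k, k)) :
  lattice_basis V (int_null a) -> a *m b = 1%:M ->
  \det (V^T *m V) = (a *m a^T) 0 0.
Proof.
move=> V_basis ab1; set A := (a *m a^T) 0 0.
have aaE : a *m a^T = A%:M by apply/matrixP => i j; rewrite !ord1 [RHS]mxE eqxx.
have aV := null_lattice_mul0 V_basis.
pose M : 'M[int]_(1 + k) := row_mx b V.
have M_unit : M \in unitmx.
  apply: unitmx_surj => x; have [y yE] := null_lattice_decomp V_basis ab1 x.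
  by exists (col_mx (a *m x) y); rewrite mul_row_col.
have detM2 : \det M ^+ 2 = 1.
  by move: M_unit; rewrite unitmxE => /orP[] /eqP->; rewrite ?sqrrN expr1n.
have [y yE] := null_lattice_decomp V_basis ab1 a^T.
have WE : row_mx a^T V = M *m block_mx A%:M 0 y 1%:M.
  by rewrite mul_row_block mulmx0 mulmx1 add0r {1}yE aaE.
have detA : \det (M *m block_mx A%:M 0 y 1%:M) = \det M * A.
  by rewrite det_mulmx det_lblock det1 mulr1 det_scalar1.
have : A * A = A * \det (V^T *m V).
  rewrite -expr2 -[LHS]mul1r -detM2 -exprMn -detA -WE expr2 -{1}det_tr -det_mulmx.
  rewrite tr_row_mx mul_col_row trmxK aaE aV -[V^T *m a^T]trmx_mul aV trmx0.
  by rewrite det_lblock det_scalar1.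
(* Cancelling [A] is allowed because [a *m b = 1] excludes [a = 0]. *)
move/esym; apply: mulfI; rewrite /A mulmx_tr_eq0; apply/eqP => a0.
by move: ab1; rewrite a0 mul0mx => /matrixP/(_ 0 0); rewrite !mxE.
Qed.

(** Apply [q] to the decomposition of each unit vector along [b] and [V]: only the [b] part
    remains. *)
Lemma row_null_lattice (F : realFieldType) (n k : nat) (a : 'rV[int]_n)
    (b : 'cV[int]_n) (V : 'M[int]_(n, k)) (q : 'rV[F]_n) :
  lattice_basis V (int_null a) -> a *m b = 1%:M ->
  q *m map_mx intr V = 0 -> q = q *m map_mx intr b *m map_mx intr a.
Proof.
move=> V_basis ab1 qV; apply/rowP => j.
have [y /(congr1 (map_mx (intr : int -> F)))] :=
  null_lattice_decomp V_basis ab1 (delta_mx j 0).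
rewrite map_mxD !map_mxM map_delta_mx => /(congr1 (mulmx q)).
rewrite mulmxDr !mulmxA qV mul0mx addr0 -!colE => /matrixP/(_ 0 0).
by rewrite !mxE.
Qed.

(* With [w] the last column of [Bs], [p - (c / W) w^T] annihilates the lattice,
   so it is a multiple of [a]. *)
Lemma dual_row_norm (F : realFieldType) (n k : nat) (a : 'rV[int]_n)
    (b : 'cV[int]_n) (V : 'M[int]_(n, k.+1)) (Bs : 'M[F]_(n, k.+1))
    (p : 'rV[F]_n) (c : F) :
  lattice_basis V (int_null a) -> a *m b = 1%:M ->
  gram_schmidt (map_mx intr V) Bs -> c ^+ 2 = 1 ->
  p *m map_mx intr V = c *: delta_mx 0 ord_max ->
  let W := dotc (col ord_max Bs) (col ord_max Bs) in
  let aF : 'rV[F]_n := map_mx intr a in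
  let A := (aF *m aF^T) 0 0 in
  W != 0 ->
  W * (A * (p *m p^T) 0 0 - (aF *m p^T) 0 0 ^+ 2) = A.
Proof.
move=> V_basis ab1 gsV c2 pV W aF A W0.
set w := col ord_max Bs.
(* The columns of [Bs] are combinations of those of [V], all orthogonal to [a]. *)
have aw : aF *m w = 0.
  rewrite /w -[Bs](mulmxK (gs_mx_unit (map_mx intr V) Bs)) -(gs_factor gsV).
  by rewrite colE !mulmxA -map_mxM (null_lattice_mul0 V_basis) map_mx0 !mul0mx.
have wa : w^T *m aF^T = 0 by rewrite -trmx_mul aw trmx0.
have qV : (p - (c / W) *: w^T) *m map_mx intr V = 0.
  by rewrite mulmxBl pV -scalemxAl (gs_last_mul gsV) scalerA divfK ?subrr.
have [t pE] : exists t : F, p = t *: aF + (c / W) *: w^T.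
  exists (((p - (c / W) *: w^T) *m map_mx intr b) 0 0).
  rewrite -[LHS](subrK ((c / W) *: w^T)); congr (_ + _).
  by rewrite {1}(row_null_lattice V_basis ab1 qV) {1}[_ *m map_mx intr b]mx11_scalar mul_scalar_mx.
(* As [aF] and [w] are orthogonal, the terms in [t] cancel in the Gram determinant of [aF] and [p],
   leaving [c ^+ 2 * A / W]. *)
have sE : (aF *m p^T) 0 0 = t * A.
  by rewrite pE linearD !linearZ /= trmxK mulmxDr -!scalemxAr aw scaler0 addr0 mxE.
have PE : (p *m p^T) 0 0 = t ^+ 2 * A + (c / W) ^+ 2 * W.
  rewrite {2}pE linearD !linearZ /= trmxK mulmxDr -!scalemxAr.
  rewrite pE !mulmxDl -!scalemxAl aw wa !scaler0 addr0 add0r.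
  by rewrite !scalerA -!expr2 mxE; congr (_ + _); rewrite mxE.
have -> : A * (p *m p^T) 0 0 - (aF *m p^T) 0 0 ^+ 2 = c ^+ 2 * A / W.
  by rewrite sE PE; field.
by rewrite c2 mul1r mulrC divfK.
Qed.

(** * Euclidean norms and the numerical estimates behind [gbound] *)

Lemma enormE (R : realType) (n : nat) (v : 'rV[R]_n) :
  enorm v = Num.sqrt ((v *m v^T) 0 0).
Proof. by rewrite /enorm mulmx_trE. Qed.

Lemma enorm_ge0 (R : realType) (n : nat) (v : 'rV[R]_n) : 0 <= enorm v.
Proof. exact: sqrtr_ge0. Qed.

Lemma sqr_enorm (R : realType) (n : nat) (v : 'rV[R]_n) :
  enorm v ^+ 2 = (v *m v^T) 0 0.
Proof. by rewrite enormE sqr_sqrtr // mulmx_tr_ge0. Qed.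

Lemma mul_bin2_2 (k : nat) : ('C(k.+1, 2) * 2 = k.+1 * k)%N.
Proof. by rewrite mulnC -(mul_bin_diag k.+1 1) bin1. Qed.

Lemma gbound_ge0 (R : realType) (n : nat) (a : 'rV[R]_n) : 0 <= gbound a.
Proof. by rewrite divr_ge0 ?powR_ge0. Qed.

(** With [n = k.+2], the power [2 * k.+1] of [gbound a] is [2 ^+ 'C(k.+1, 2) / enorm a ^+ 2], so the
    claim is the hypothesis after taking [k.+1]-st powers. *)
Lemma gbound_sqr_ge (R : realType) (k : nat) (a : 'rV[R]_k.+2) (W : R) :
  0 < enorm a -> 0 < W ->
  enorm a ^+ 2 <= 2 ^+ 'C(k.+1, 2) * W ^+ k.+1 ->
  W^-1 <= gbound a ^+ 2.
Proof.
move=> a_gt0 W_gt0 aW.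
rewrite -(@ler_pXn2r _ k.+1) ?nnegrE ?invr_ge0 ?(ltW W_gt0) ?sqr_ge0 //.
have k1 : k.+2%:R - 1 = k.+1%:R :> R by rewrite -natr1 addrK.
have num : (2 `^ ((k.+2%:R - 2) / 4)) ^+ (2 * k.+1) = 2 ^+ 'C(k.+1, 2) :> R.
  rewrite -!powR_mulrn ?powR_ge0 // -powRrM; congr (_ `^ _).
  have := congr1 (fun m => m%:R : R) (mul_bin2_2 k).
  by rewrite !natrM => e; rewrite -[k.+2%:R]natr1 -natr1 in e *; lra.
have den : (enorm a `^ (1 / (k.+2%:R - 1))) ^+ (2 * k.+1) = enorm a ^+ 2.
  rewrite -!powR_mulrn ?powR_ge0 ?enorm_ge0 // -powRrM; congr (_ `^ _).
  by rewrite k1 natrM mulrCA div1r mulVf ?mulr1 // pnatr_eq0.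
rewrite -exprM /gbound expr_div_n num den exprVn.
rewrite ler_pdivlMr ?exprn_gt0 // mulrC ler_pdivrMr ?exprn_gt0 //.
Qed.

(** If [W < 2], then [A] is at most 2 to the power ['C(k.+1, 2) + k.+1 = (k+1)(k+2)/2], which is
    smaller than [(k+4)(k+2)]. *)
Lemma last_gs_ge2 (F : realFieldType) (k : nat) (A W : F) :
  0 <= W -> 2 ^+ (k.+4 * k.+2) <= A -> A <= 2 ^+ 'C(k.+1, 2) * W ^+ k.+1 ->
  2 <= W.
Proof.
move=> W_ge0 le_A A_le; rewrite leNgt; apply/negP => W_lt2.
have : W ^+ k.+1 <= 2 ^+ k.+1 by rewrite lerXn2r ?nnegrE // ltW.
rewrite -(@ler_pM2l _ (2 ^+ 'C(k.+1, 2))) ?exprn_gt0 //.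
move=> /(le_trans A_le) /(le_trans le_A); rewrite -exprD ler_eXn2l ?ltr1n //.
by have := mul_bin2_2 k; nia.
Qed.

(** * The matrix [(V, b)] and the rows of its inverse *)

Lemma append_col_widen (T : Type) (k : nat) (V : 'M[T]_(k.+1, k))
    (b : 'cV[T]_k.+1) (i : 'I_k.+1) (j : 'I_k) :
  (append_col V b : 'M[T]_k.+1) i (widen_ord (leqnSn k) j) = V i j.
Proof.
rewrite mxE; case: insubP => [j' _ e|]; last by rewrite /= ltn_ord.
by congr (V i _); apply: val_inj.
Qed.

Lemma append_col_last (T : Type) (k : nat) (V : 'M[T]_(k.+1, k))
    (b : 'cV[T]_k.+1) (i : 'I_k.+1) :
  (append_col V b : 'M[T]_k.+1) i ord_max = b i 0.
Proof. by rewrite mxE insubF //= ltnn. Qed.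

Lemma append_col_unit (k : nat) (a : 'rV[int]_k.+1) (b : 'cV[int]_k.+1)
    (V : 'M[int]_(k.+1, k)) :
  lattice_basis V (int_null a) -> a *m b = 1%:M ->
  (append_col V b : 'M[int]_k.+1) \in unitmx.
Proof.
move=> V_basis ab1; apply: unitmx_surj => x.
have [y /colP yE] := null_lattice_decomp V_basis ab1 x.
(* The coordinates [y] along [V] come first; the coordinate [a *m x] along [b] comes last. *)
exists (\col_j if unlift ord_max j is Some j' then y j' 0 else (a *m x) 0 0).
apply/colP => i; rewrite yE !mxE big_ord1 big_ord_recr /= addrC; congr (_ + _).
  apply: eq_bigr => j _; rewrite append_col_widen mxE.
  have -> : widen_ord (leqnSn k) j = lift ord_max j.
    by apply: val_inj; rewrite /= /bump leqNgt ltn_ord.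
  by rewrite liftK.
by rewrite append_col_last !mxE unlift_none.
Qed.

(** The inverse over [F] is the image of the integral inverse, whence integrality. Row [k], counted
    from 0, is dual to the last column of [V]. *)
Lemma row_inv_append_col (F : fieldType) (k : nat) (V : 'M[int]_(k.+2, k.+1))
    (b : 'cV[int]_k.+2) (i : 'I_k.+2) :
  i = k :> nat -> (append_col V b : 'M[int]_k.+2) \in unitmx ->
  let q := row i (invmx (map_mx intr (append_col V b) : 'M[F]_k.+2)) in
  (exists z : 'rV[int]_k.+2, q = map_mx intr z) /\
  q *m map_mx intr V = delta_mx 0 ord_max.
Proof.
move=> ik; set M : 'M_k.+2 := append_col V b => M_unit q.
have MF_unit : (map_mx intr M : 'M[F]_k.+2) \in unitmx.
  by rewrite unitmxE det_map_mx rmorph_unit.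
split.
  exists (row i (invmx M)); rewrite /q map_row; congr (row i _).
  rewrite -[LHS]mulmx1 -(map_mx1 (intr : int -> F)) -(mulmxV M_unit) map_mxM.
  by rewrite mulKmx.
have qM : q *m map_mx intr M = delta_mx 0 i.
  by rewrite /q -row_mul mulVmx // row1.
apply/rowP => j; have /rowP/(_ (widen_ord (leqnSn _) j)) := qM.
rewrite !mxE !eqxx /=.
have -> : (widen_ord (leqnSn k.+1) j == i) = (j == ord_max).
  by rewrite -!val_eqE /= ik.
by move=> <-; apply: eq_bigr => l _; rewrite ![map_mx _ _ _ _]mxE append_col_widen.
Qed.

(** * Bounds for [p], [r] and [lam], and the theorem *)

Lemma int_row_norm_ge1 (F : realFieldType) (n : nat) (z : 'rV[int]_n) :
  let zF : 'rV[F]_n := map_mx intr z in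
  zF != 0 -> 1 <= (zF *m zF^T) 0 0.
Proof.
move=> zF; rewrite -mulmx_tr_gt0 /zF map_trmx -map_mxM mxE.
by rewrite ltr0z gtz0_ge1 -(ler1z F).
Qed.

(** Here [A], [P], [Q] stand for the squared norms of [a], [p], [r], and [lam * P] for the product
    of [a] and [p]. The first equation becomes [W * P * Q = A], and then the second gives
    [lam ^+ 2 * P = Q * (W * P - 1)] with [W * P >= 2]. *)
Lemma decomp_bounds (F : realFieldType) (A P Q W lam : F) :
  2 <= W -> 0 < A -> 1 <= P ->
  W * (A * P - (lam * P) ^+ 2) = A -> A = lam ^+ 2 * P + Q ->
  [/\ lam != 0, 0 < Q, P * Q = A * W^-1 & Q <= 4 * W^-1 * lam ^+ 2].
Proof.
move=> W2 A_gt0 P1 WE AE.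
have W_gt0 : 0 < W by lra.
have P_gt0 : 0 < P by lra.
have PQ : P * Q = A * W^-1.
  by rewrite -{1}WE mulrAC divff ?gt_eqF // mul1r AE; ring.
have Q_gt0 : 0 < Q by rewrite -(pmulr_rgt0 _ P_gt0) PQ divr_gt0.
have WP2 : 2 <= W * P by rewrite -[2]mulr1 ler_pM.
have lamE : lam ^+ 2 * P = Q * (W * P - 1).
  have -> : Q * (W * P - 1) = W * (P * Q) - Q by ring.
  by rewrite PQ mulrCA divff ?gt_eqF // mulr1 AE addrK.
split=> //.
  apply/eqP => lam0; move: lamE; rewrite lam0 expr0n mul0r => /esym/eqP.
  by rewrite mulf_eq0 !gt_eqF //; lra.
(* Multiplying by [W * P] and cancelling [Q] reduces the claim to [W * P <= 4 * (W * P - 1)]. *)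
rewrite mulrAC ler_pdivlMr // -(ler_pM2r P_gt0) -mulrA -[leRHS]mulrA lamE.
by rewrite [leRHS]mulrCA ler_pM2l //; lra.
Qed.

Theorem theorem4 (R : realType) (n : nat) (hn : (2 <= n)%N)
  (a : 'rV[int]_n)
  (a_pos : forall j : 'I_n, 0 < a 0 j)
  (a_gcd : \big[gcdn/0%N]_(j < n) absz (a 0 j) = 1%N)
  (a_large : 2 `^ ((n%:R / 2 + 1) * n%:R) <= enorm (map_mx intr a : 'rV[R]_n))
  (V : 'M[int]_(n, n.-1))
  (V_basis : lattice_basis V (int_null a))
  (V_LLL : LLL_reduced (map_mx intr V : 'M[rat]_(n, n.-1)))
  (b : 'cV[int]_n) (ab1 : a *m b = 1%:M)
  (* i is the 0-based index n - 2 of the (n-1)st row *)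
  (i : 'I_n) (hi : i.+2 = n)
  (p : 'rV[rat]_n)
  (hp : let q := row i (invmx (map_mx intr (append_col V b) : 'M[rat]_n)) in
        p = q \/ p = - q)
  (lam : rat) (r : 'rV[rat]_n)
  (a_decomp : map_mx intr a = lam *: p + r)
  (r_perp : r *m p^T = 0) :
  lam != 0 /\
  (0 < lam ->
   let aR := map_mx intr a : 'rV[R]_n in
   let pR := map_mx ratr p : 'rV[R]_n in
   let rR := map_mx ratr r : 'rV[R]_n in
   [/\ r != 0,
       enorm pR * enorm rR <= enorm aR * gbound aR
     & enorm rR / ratr lam <= 2 * gbound aR]).
Proof.
destruct n as [|[|k]] => //; rewrite /= in V V_basis V_LLL hp.
have [_ [Bs [gsV _ lovasz]]] := V_LLL.
set W := dotc (col ord_max Bs) (col ord_max Bs).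
pose aQ : 'rV[rat]_k.+2 := map_mx intr a; pose A := (aQ *m aQ^T) 0 0.
have ik : i = k :> nat by case: hi.
have M_unit := append_col_unit V_basis ab1.
have [[z zE] qV] := row_inv_append_col rat ik M_unit.
(* The sign [c] covers both choices of [p]. *)
have [c c2 [[y yE] pV]] : exists2 c : rat, c ^+ 2 = 1 &
    (exists y : 'rV[int]_k.+2, p = map_mx intr y) /\
    p *m map_mx intr V = c *: delta_mx 0 ord_max.
  case: hp => /= ->; [exists 1 | exists (-1)]; rewrite ?sqrrN ?expr1n //.
    by split; [exists z | rewrite scale1r].
  by split; [exists (- z); rewrite map_mxN -zE | rewrite mulNmx qV scaleN1r].
have p_neq0 : p != 0.
  apply/eqP => p0; move: pV; rewrite p0 mul0mx => /rowP/(_ ord_max).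
  by rewrite !mxE !eqxx mulr1 => c0; move: c2; rewrite -c0 expr0n => /eqP.
have P1 : 1 <= (p *m p^T) 0 0 by move: p_neq0; rewrite yE; apply: int_row_norm_ge1.
have AE : A = ((a *m a^T) 0 0)%:~R by rewrite /A /aQ map_trmx -map_mxM mxE.
have A_le : A <= 2 ^+ 'C(k.+1, 2) * W ^+ k.+1.
  rewrite AE -(det_gram_null_lattice V_basis ab1) -det_map_mx map_mxM -map_trmx.
  by rewrite (det_gram gsV); apply: LLL_prod_le.
have ratrA : ratr A = enorm (map_mx intr a : 'rV[R]_k.+2) ^+ 2.
  by rewrite sqr_enorm map_trmx -map_mxM mxE AE ratr_int.
(* Squaring the lower bound on the norm turns the exponent into the integer [(n + 2) * n] with
   [n = k.+2]. *)
have A_ge : 2 ^+ (k.+4 * k.+2) <= A.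
  rewrite -(ler_rat R) ratrA rmorphXn /= rmorph_nat.
  apply: le_trans (_ : (2 `^ ((k.+2%:R / 2 + 1) * k.+2%:R)) ^+ 2 <= _).
    rewrite -!powR_mulrn ?powR_ge0 // -powRrM ler_powR ?ler1n //.
    by rewrite natrM -[k.+4]addn2 natrD; lra.
  by rewrite lerXn2r ?nnegrE ?powR_ge0 ?enorm_ge0.
have W_ge0 : 0 <= W by apply: dotc_ge0.
have W2 := last_gs_ge2 W_ge0 A_ge A_le.
have A_gt0 : 0 < A by apply: lt_le_trans A_ge; rewrite exprn_gt0.
have W_neq0 : W != 0 by rewrite gt_eqF //; apply: lt_le_trans W2.
have pr : p *m r^T = 0 by rewrite -[LHS]trmxK trmx_mul trmxK r_perp trmx0.
have sE : (aQ *m p^T) 0 0 = lam * (p *m p^T) 0 0.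
  by rewrite /aQ a_decomp mulmxDl r_perp addr0 -scalemxAl mxE.
have A_split : A = lam ^+ 2 * (p *m p^T) 0 0 + (r *m r^T) 0 0.
  rewrite /A /aQ a_decomp linearD linearZ /= mulmxDr !mulmxDl -!scalemxAr -!scalemxAl.
  by rewrite pr r_perp !scaler0 addr0 add0r scalerA -expr2 mxE; congr (_ + _); rewrite mxE.
have := dual_row_norm V_basis ab1 gsV c2 pV W_neq0; rewrite -/W -/aQ -/A sE => normE.
have [lam_neq0 Q_gt0 PQ Q_le] := decomp_bounds W2 A_gt0 P1 normE A_split.
split=> // lam_gt0 aR pR rR.
have ratr_norm (v : 'rV[rat]_k.+2) :
    enorm (map_mx ratr v : 'rV[R]_k.+2) ^+ 2 = ratr ((v *m v^T) 0 0).
  by rewrite sqr_enorm map_trmx -map_mxM mxE.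
have g_ge0 := gbound_ge0 aR.
have a_gt0 : 0 < enorm aR.
  by rewrite lt0r enorm_ge0 andbT -sqrf_eq0 -ratrA fmorph_eq0 gt_eqF.
have g2 : ratr W^-1 <= gbound aR ^+ 2.
  rewrite fmorphV; apply: gbound_sqr_ge => //.
    by rewrite ltr0q; apply: lt_le_trans W2.
  rewrite -ratrA; move: A_le; rewrite -(ler_rat R).
  by rewrite rmorphM !rmorphXn /= rmorph_nat.
move: (gbound aR) g_ge0 g2 => g g_ge0 g2; split.
- by rewrite -mulmx_tr_gt0.
(* Squared, the claim is [P * Q = A / W <= A * g ^+ 2]. *)
- rewrite -(@ler_pXn2r _ 2) ?nnegrE ?mulr_ge0 ?enorm_ge0 //.
  rewrite !exprMn !ratr_norm -ratrA -rmorphM PQ rmorphM /=.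
  by rewrite ler_pM2l // ltr0q.
- have lamR_gt0 : 0 < ratr lam :> R by rewrite ltr0q.
  (* Squared, the claim follows from [Q <= 4 / W * lam ^+ 2] and [1 / W <= g ^+ 2]. *)
  rewrite ler_pdivrMr // -(@ler_pXn2r _ 2) ?nnegrE ?enorm_ge0 //; last first.
    by rewrite pmulr_lge0 ?mulr_ge0.
  rewrite ratr_norm [leRHS]exprMn [X in X * _]exprMn.
  move: Q_le; rewrite -(ler_rat R) => /le_trans; apply.
  rewrite rmorphM rmorphXn rmorphM /= rmorph_nat ler_pM2r ?exprn_gt0 //.
  by rewrite -natrX ler_pM2l.
Qed.
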